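(* Let $n$ be a positive integer and let $X=\{X_1,\dots,X_{n+2}\}$ be a set of $n+2$ cycles in $\mathbb{R}^n$. Suppose that for every $1\le i\le n+2$, $$Ap(X\setminus\{X_i\})=\{A_i,A_i'\},\qquad A_i\neq A_i'.$$ Let $A=\{A_1,\dots,A_{n+2}\}$ and $A'=\{A_1',\dots,A_{n+2}'\}$ (families indexed by $1,\dots,n+2$), and suppose that for every $1\le i\le n+2$ there are cycles $B_i,B_i'$ with $$Ap(A\setminus\{A_i\})=\{X_i,B_i\},\qquad Ap(A'\setminus\{A_i'\})=\{X_i,B_i'\},$$ where $A\setminus\{A_i\}$ is the family of all $A_j$ with $j\ne i$, and similarly for $A'$. Then the lines through the centers of the pairs of cycles $B_1,B_1'$; $B_2,B_2'$; $\dots$; $B_n,B_n'$, where $B_i\neq B_i'$ for all $i$, are concurrent at the point $P_X$.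
   Context: Let $V=\mathbb{R}^{n+3}$ with the symmetric bilinear form of signature $(n+1,2)$ $$(X|Y)=-x_1y_1+\sum_{i=2}^{n+1}x_iy_i+x_{n+2}y_{n+3}+x_{n+3}y_{n+2}.$$ Let $\mathbb{P}(V)$ be the projective space of $V$, and let $[X]$ be the class of a nonzero $X\in V$. The Lie quadric is $Q=\{[X]\in\mathbb{P}(V):(X|X)=0\}$. Cycles (oriented spheres, point spheres and oriented hyperplanes) in $\mathbb{R}^n$ are represented by points of $Q$. The point $[X]\in Q$ with $X=(r,c_1,\dots,c_n,v,w)$ represents the set $\{x\in\mathbb{R}^n: v|x|^2-2(c_1x_1+\dots+c_nx_n)-2w=0\}$, where $2vw=r^2-(c_1^2+\dots+c_n^2)$. If $v\ne0$ it is an oriented sphere with center $(c_1/v,\dots,c_n/v)$ and signed radius $r/v$ (possibly $0$); if $v=0$ it is an oriented hyperplane. A cycle is identified with the point of $Q$ representing it. Two cycles $[X],[Y]$ are tangent iff $(X|Y)=0$ (oriented contact). For cycles $[Y_1],\dots,[Y_k]$ put $Ap([Y_1],\dots,[Y_k])=\{[X]\in Q:(X|Y_j)=0 \text{ for all } j\}$. The center of a cycle is the homogeneous point $[c_1:\dots:c_n:v]\in\mathbb{RP}^n$; it is a point at infinity when $v=0$. The line through two centers is the projective line in $\mathbb{RP}^n$ through them, considered whenever the two centers are defined (that is, $(c_1,\dots,c_n,v)\neq 0$) and distinct. The point $P_X$: choose $[P]=[p_1:\dots:p_{n+3}]\in\mathbb{P}(V)$ with $(P|X_i)=0$ for all $1\le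 i\le n+2$ (such a point exists). Then $P_X=[p_2:\dots:p_{n+1}:p_{n+2}]\in\mathbb{RP}^n$. It is a common point of the lines through the centers of the pairs $A_i,A_i'$. *)

(* Defs.v *)
From HB Require Import structures.
From mathcomp Require Import all_boot all_order all_algebra.
From mathcomp Require Import classical_sets reals.

Set Implicit Arguments.
Unset Strict Implicit.
Unset Printing Implicit Defensive.

Import GRing.Theory.

Local Open Scope ring_scope.
Local Open Scope classical_set_scope.

(* A point of P(vT) is a one-dimensional subspace, so Leibniz equality of
   points is equality of classes [x]. *)
Definition proj (K : fieldType) (vT : vectType K) : Type :=
  {U : {vspace vT} | \dim U == 1%N}.

Definition rep (K : fieldType) (vT : vectType K) (p : proj vT) : vT :=
  vpick (val p).

Lemma rep_neq0 (K : fieldType) (vT : vectType K) (p : proj vT) : rep p != 0.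
Proof. by rewrite vpick0 -dimv_eq0 (eqP (valP p)). Qed.

Lemma line_rep (K : fieldType) (vT : vectType K) (p : proj vT) :
  <[rep p]>%VS = val p.
Proof.
apply/eqP; rewrite eqEdim -memvE memv_pick /=.
by rewrite dim_vline rep_neq0 (eqP (valP p)).
Qed.

Definition proj_line (K : fieldType) (vT : vectType K) (p q : proj vT) :
  {vspace vT} := (val p + val q)%VS.

Definition on_line (K : fieldType) (vT : vectType K) (p : proj vT)
  (L : {vspace vT}) : bool := (val p <= L)%VS.

(* The coordinates x_1, ..., x_{n+3} = (r, c_1, ..., c_n, v, w) have the
   0-based indices 0, 1, ..., n, n+1, n+2. *)
Definition lie_form (R : realType) (n : nat) (x y : 'rV[R]_n.+3) : R :=
  - (x 0 ord0 * y 0 ord0)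
  + \sum_(i < n) x 0 (inord i.+1) * y 0 (inord i.+1)
  + x 0 (inord n.+1) * y 0 (inord n.+2)
  + x 0 (inord n.+2) * y 0 (inord n.+1).

Lemma lie_formZ (R : realType) (n : nat) (a b : R) (x y : 'rV[R]_n.+3) :
  lie_form (a *: x) (b *: y) = a * b * lie_form x y.
Proof.
have e k l : (a *: x) 0 k * (b *: y) 0 l = a * b * (x 0 k * y 0 l).
  by rewrite !mxE mulrACA.
rewrite /lie_form !e !mulrDr mulrN mulr_sumr.
by under eq_bigr => i _ do rewrite e.
Qed.

Definition orth (R : realType) (n : nat) (p q : proj 'rV[R]_n.+3) : bool :=
  lie_form (rep p) (rep q) == 0.

Lemma orthP (R : realType) (n : nat) (p q : proj 'rV[R]_n.+3) :
  reflect (forall x y, x \in val p -> y \in val q -> lie_form x y = 0)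
          (orth p q).
Proof.
apply: (iffP eqP) => [h x y | h]; last by apply: h; exact: memv_pick.
rewrite -!line_rep => /vlineP[a ->] /vlineP[b ->].
by rewrite lie_formZ h mulr0.
Qed.

(* The points of the Lie quadric Q. *)
Definition lie_cycle (R : realType) (n : nat) : Type :=
  {p : proj 'rV[R]_n.+3 | orth p p}.

Definition tangent (R : realType) (n : nat) (X Y : lie_cycle R n) : bool :=
  orth (val X) (val Y).

Definition Ap (R : realType) (n : nat) (S : set (lie_cycle R n)) :
  set (lie_cycle R n) := [set X | forall Y, S Y -> tangent X Y].

(* All the members Y_j with j != i, also those that happen to equal Y_i. *)
Definition omit (R : realType) (n k : nat) (Y : 'I_k -> lie_cycle R n)
  (i : 'I_k) : set (lie_cycle R n) := [set Y j | j in [set j | j != i]].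

Definition center_row (R : realType) (n : nat) (x : 'rV[R]_n.+3) :
  'rV[R]_n.+1 := \row_k x 0 (inord k.+1).

(* [c_1 : ... : c_n : v]; None when these coordinates all vanish.  It is
   defined on all of P(V), not only on Q, because P_X is the center of a
   point which need not lie on Q. *)
Definition lie_center (R : realType) (n : nat) (p : proj 'rV[R]_n.+3) :
  option (proj 'rV[R]_n.+1) := insub <[center_row (rep p)]>%VS.

Lemma centerP (R : realType) (n : nat) (p : proj 'rV[R]_n.+3)
    (c : proj 'rV[R]_n.+1) :
  lie_center p = Some c <->
  (forall x, x \in val p -> x != 0 ->
     center_row x != 0 /\ val c = <[center_row x]>%VS).
Proof.
have crZ a (x : 'rV[R]_n.+3) : center_row (a *: x) = a *: center_row x.
  by apply/rowP => k; rewrite !mxE.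
rewrite /lie_center; split=> [h x | h].
  have e : val c = <[center_row (rep p)]>%VS.
    by move: h; case: insubP => // u _ <- [->].
  have nz : center_row (rep p) != 0.
    by have := valP c; rewrite e dim_vline; case: (_ != 0).
  rewrite -line_rep => /vlineP[a ->].
  rewrite scaler_eq0 negb_or => /andP[a0 _].
  rewrite crZ scaler_eq0 negb_or a0 nz; split=> //.
  rewrite e; apply/eqP; rewrite eqEdim -memvE; apply/andP; split.
    apply/vlineP; exists a^-1; first by rewrite scalerA mulVf // scale1r.
  by rewrite !dim_vline scaler_eq0 (negPf a0) nz.
have [nz e] := h (rep p) (memv_pick _) (rep_neq0 p).
by rewrite -e valK.
Qed.

(* Main.v *)
Require Import Defs.
From HB Require Import structures.
From mathcomp Require Import all_boot all_order all_algebra.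
From mathcomp Require Import classical_sets reals.
From mathcomp Require Import ring.

Set Implicit Arguments.
Unset Strict Implicit.
Unset Printing Implicit Defensive.

Local Open Scope ring_scope.
Local Open Scope classical_set_scope.

(** Let P be orthogonal to all the X_i.  The complement of X \ {X_i} contains
    exactly two isotropic lines, hence is a hyperbolic plane spanned by A_i and
    A_i', and contains P.  If P were isotropic, it would be one of A_i, A_i' for
    every i, so by pigeonhole A_i = A_j = P, say, for some i <> j; then X_i and
    X_j are tangent to every A_l, and Ap (A \ {A_k}) contains the three cycles
    X_i, X_j, X_k.  So P is not isotropic, and the reflection in P fixes every
    X_i and swaps A_i with A_i', hence maps B_i to B_i'.  Thus P lies on the
    line through B_i and B_i', and projecting this line to the centers gives
    the claim. *)

Import GRing.Theory.

(** * Bilinearity of the Lie form and reflections *)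

Section LieForm.
Variables (R : realType) (n : nat).
Implicit Types x y z p : 'rV[R]_n.+3.

Lemma lie_formC x y : lie_form x y = lie_form y x.
Proof.
rewrite /lie_form; under eq_bigr => i _ do rewrite mulrC.
by ring.
Qed.

Lemma lie_formDl x y z : lie_form (x + y) z = lie_form x z + lie_form y z.
Proof.
rewrite /lie_form !mxE; under eq_bigr => i _ do rewrite mxE mulrDl.
by rewrite big_split /=; ring.
Qed.

Lemma lie_formZl a x y : lie_form (a *: x) y = a * lie_form x y.
Proof. by rewrite -[y in LHS]scale1r lie_formZ mulr1. Qed.

Lemma lie_formDr x y z : lie_form x (y + z) = lie_form x y + lie_form x z.
Proof. by rewrite lie_formC lie_formDl !(lie_formC x). Qed.

Lemma lie_formZr a x y : lie_form x (a *: y) = a * lie_form x y.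
Proof. by rewrite lie_formC lie_formZl lie_formC. Qed.

Definition lie_formE := (lie_formDl, lie_formDr, lie_formZl, lie_formZr).

(** The reflection in the hyperplane orthogonal to [p], sending [p] to [-p]; for isotropic [p] the
    division by zero makes it the identity. *)
Definition refl p x := x + (- (2 * lie_form x p / lie_form p p)) *: p.

Lemma refl_isom p x y : lie_form p p != 0 ->
  lie_form (refl p x) (refl p y) = lie_form x y.
Proof.
by move=> p0; rewrite /refl !lie_formE (lie_formC p y); field.
Qed.

Lemma reflK p : lie_form p p != 0 -> involutive (refl p).
Proof.
move=> p0 x; rewrite {1}/refl lie_formDl lie_formZl.
by apply/rowP => k; rewrite !mxE; field.
Qed.

Lemma refl0 p : refl p 0 = 0.
Proof.
have e : lie_form 0 p = 0 by rewrite -(scale0r 0) lie_formZl mul0r.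
by rewrite /refl e mulr0 mul0r oppr0 scale0r addr0.
Qed.

Lemma refl_neq0 p x : lie_form p p != 0 -> x != 0 -> refl p x != 0.
Proof.
by move=> p0; apply: contraNneq => e; rewrite -(reflK p0 x) e refl0.
Qed.

Lemma refl_orth p x : lie_form x p = 0 -> refl p x = x.
Proof. by rewrite /refl => ->; rewrite mulr0 mul0r oppr0 scale0r addr0. Qed.

End LieForm.

(** * Projective points and the vectors on them *)

Section Points.
Variables (K : fieldType) (vT : vectType K).

Lemma proj_inj (p q : proj vT) (x : vT) :
  x != 0 -> x \in val p -> x \in val q -> p = q.
Proof.
move=> x0 xp xq; apply: val_inj.
have line (r : proj vT) : x \in val r -> <[x]>%VS = val r.
  move=> xr; apply/eqP; rewrite eqEdim -memvE xr /=.
  by rewrite dim_vline x0 (eqP (valP r)).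
by rewrite -(line p) // -(line q).
Qed.

Lemma proj_memP (p : proj vT) (x : vT) :
  reflect (exists a, x = a *: rep p) (x \in val p).
Proof. by rewrite -line_rep; exact: vlineP. Qed.

End Points.

(** * Families with exactly two common tangent cycles *)

Section Apollonius.
Variables (R : realType) (n : nat).
Implicit Types (C D E : lie_cycle R n) (S : set (lie_cycle R n)).
Local Notation vec C := (rep (val C)).

Lemma cycle_exists (x : 'rV[R]_n.+3) : x != 0 -> lie_form x x = 0 ->
  exists C, x \in val (val C).
Proof.
move=> x0 xx.
have d : \dim <[x]>%VS == 1%N by rewrite dim_vline x0.
pose p : proj 'rV[R]_n.+3 := exist (fun U => \dim U == 1%N) <[x]>%VS d.
have pp : orth p p.
  by apply/orthP => y z /vlineP[a ->] /vlineP[b ->]; rewrite lie_formZ xx mulr0.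
by exists (exist _ p pp : lie_cycle R n); exact: memv_line.
Qed.

Lemma tangentE C D : reflect (lie_form (vec C) (vec D) = 0) (tangent C D).
Proof. exact: eqP. Qed.

Lemma vec_isotropic C : lie_form (vec C) (vec C) = 0.
Proof. by apply/tangentE; exact: valP C. Qed.

Lemma cycle_inj C D (x : 'rV[R]_n.+3) :
  x != 0 -> x \in val (val C) -> x \in val (val D) -> C = D.
Proof. by move=> x0 xC xD; apply: val_inj; exact: proj_inj x0 xC xD. Qed.

Section Pair.
Variables (S : set (lie_cycle R n)) (C D : lie_cycle R n).
Hypothesis SCD : Ap S = [set C; D].

(** A nonzero isotropic vector spans a cycle, so the description of [Ap S] carries over from cycles
    to vectors. *)
Lemma Ap_isotropic (x : 'rV[R]_n.+3) : x != 0 -> lie_form x x = 0 ->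
  (forall E, S E -> lie_form x (vec E) = 0) ->
  x \in val (val C) \/ x \in val (val D).
Proof.
move=> x0 xx xS; have [F xF] := cycle_exists x0 xx.
have : Ap S F.
  move=> E SE; apply/tangentE; have /proj_memP[a e] := xF.
  have := xS E SE; rewrite e lie_formZl => /eqP; rewrite mulf_eq0.
  case/orP => /eqP // a0; by rewrite e a0 scale0r eqxx in x0.
by rewrite SCD => -[<-|<-]; [left|right].
Qed.

Lemma Ap_l E : S E -> lie_form (vec C) (vec E) = 0.
Proof. by have h : Ap S C; [rewrite SCD; left | move=> /h/tangentE]. Qed.

Lemma Ap_r E : S E -> lie_form (vec D) (vec E) = 0.
Proof. by have h : Ap S D; [rewrite SCD; right | move=> /h/tangentE]. Qed.

Hypothesis CD : C <> D.

Lemma pair_coef_eq0 a b (x : 'rV[R]_n.+3) : x = a *: vec C + b *: vec D ->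
  (x \in val (val C) -> b = 0) /\ (x \in val (val D) -> a = 0).
Proof.
have coef0 E F c d y : E <> F -> y = c *: vec E + d *: vec F ->
    y \in val (val E) -> d = 0.
  move=> EF e yE; apply/eqP; apply: contra_notT EF => d0.
  apply: (@cycle_inj _ _ (vec F) (rep_neq0 _)); last exact: memv_pick.
  have -> : vec F = d^-1 *: (y - c *: vec E).
    by rewrite e addrC addKr scalerA mulVf // scale1r.
  by rewrite memvZ // memvB // memvZ // memv_pick.
move=> e; split=> h; first exact: coef0 _ _ _ _ _ CD e h.
by apply: coef0 _ _ _ _ _ (nesym CD) _ h; rewrite addrC; exact: e.
Qed.

(** Were [C] and [D] orthogonal, the sum of their representatives would be isotropic and would span
    a third cycle of [Ap S]. *)
Lemma Ap_pair_form_neq0 : lie_form (vec C) (vec D) != 0.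
Proof.
apply/eqP => CD0.
pose x := 1 *: vec C + 1 *: vec D.
have [xC xD] := pair_coef_eq0 (erefl x).
have x0 : x != 0.
  apply/eqP => e; have /xD/eqP : x \in val (val D) by rewrite e mem0v.
  by rewrite oner_eq0.
have xx : lie_form x x = 0.
  by rewrite /x !lie_formE !vec_isotropic (lie_formC (vec D)) CD0; ring.
have xS E : S E -> lie_form x (vec E) = 0.
  by move=> SE; rewrite /x !lie_formE Ap_l // Ap_r //; ring.
by case: (Ap_isotropic x0 xx xS) => [/xC|/xD] /eqP; rewrite oner_eq0.
Qed.

Lemma Ap_pair_span (x : 'rV[R]_n.+3) :
  (forall E, S E -> lie_form x (vec E) = 0) ->
  exists a b, x = a *: vec C + b *: vec D.
Proof.
move=> xS; have c0 := Ap_pair_form_neq0; set c := lie_form _ _ in c0.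
(* Projection of [x] to the hyperbolic plane of [C] and [D]: both are isotropic, so pairing with one
   isolates the coefficient of the other. *)
pose a := lie_form x (vec D) / c; pose b := lie_form x (vec C) / c.
pose u := x + (- a) *: vec C + (- b) *: vec D.
have xe : x = u + a *: vec C + b *: vec D.
  by apply/rowP => k; rewrite !mxE; ring.
have uC : lie_form u (vec C) = 0.
  by rewrite /u !lie_formE vec_isotropic (lie_formC (vec D)) -/c /b; field.
have uD : lie_form u (vec D) = 0.
  by rewrite /u !lie_formE vec_isotropic -/c /a; field.
have uS E : S E -> lie_form u (vec E) = 0.
  by move=> SE; rewrite /u !lie_formE xS // Ap_l // Ap_r //; ring.
clearbody u.
(* [y] is isotropic, so it is zero or lies on [C] or [D]; hence [u] is in
   their span. *)
pose y := u + 1 *: vec C + (- (lie_form u u / (2 * c))) *: vec D.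
suff [a' [b' ue]] : exists a' b', u = a' *: vec C + b' *: vec D.
  exists (a' + a), (b' + b); rewrite xe ue.
  by apply/rowP => k; rewrite !mxE; ring.
have ye : u = y + (-1) *: vec C + (lie_form u u / (2 * c)) *: vec D.
  by apply/rowP => k; rewrite !mxE; ring.
have [y0|y0] := eqVneq y 0.
  by exists (-1), (lie_form u u / (2 * c)); rewrite {1}ye y0 add0r.
have yy : lie_form y y = 0.
  rewrite /y !lie_formE !vec_isotropic (lie_formC (vec C) u) uC.
  by rewrite (lie_formC (vec D) u) uD (lie_formC (vec D)) -/c; field.
have yS E : S E -> lie_form y (vec E) = 0.
  by move=> SE; rewrite /y !lie_formE uS // Ap_l // Ap_r //; ring.
have [/proj_memP[t yt]|/proj_memP[t yt]] := Ap_isotropic y0 yy yS.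
  exists (t - 1), (lie_form u u / (2 * c)).
  by rewrite {1}ye yt; apply/rowP => k; rewrite !mxE; ring.
exists (-1), (t + lie_form u u / (2 * c)).
by rewrite {1}ye yt; apply/rowP => k; rewrite !mxE; ring.
Qed.

(** Write [p] as [a *: vec C + b *: vec D]. Both coefficients are nonzero since [p] is not
    isotropic, and the reflection sends [vec C] to [- (b / a) *: vec D]. *)
Lemma refl_swap p : (forall E, S E -> lie_form p (vec E) = 0) ->
  lie_form p p != 0 -> refl p (vec C) \in val (val D).
Proof.
move=> pS pp; have [a [b pe]] := Ap_pair_span pS.
pose c := lie_form (vec C) (vec D).
have c0 : c != 0 by exact: Ap_pair_form_neq0.
have Cp : lie_form (vec C) p = b * c.
  by rewrite pe !lie_formE vec_isotropic /c; ring.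
have ppE : lie_form p p = 2 * a * b * c.
  by rewrite pe !lie_formE !vec_isotropic (lie_formC (vec D)) /c; ring.
have := pp; rewrite ppE !mulf_eq0 !negb_or -!andbA => /and4P[_ a0 b0 _].
apply/proj_memP; exists (- (b / a)); rewrite /refl Cp ppE pe.
by apply/rowP => k; rewrite !mxE; field; rewrite a0 b0 c0.
Qed.

End Pair.

End Apollonius.

(** * How often [P] can occur in one family *)

Section Configuration.
Variables (R : realType) (n : nat).

Lemma omit_mem k (Y : 'I_k -> lie_cycle R n) i j : j != i -> omit Y i (Y j).
Proof. by move=> ji; exists j. Qed.

Lemma third_index (i j : 'I_n.+2) : (0 < n)%N ->
  exists l : 'I_n.+2, l != i /\ l != j.
Proof.
move=> n0; have [l|h] := pickP (mem (~: [set i; j]%SET)).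
  by rewrite !inE negb_or => /andP[li lj]; exists l.
have := cardsC [set i; j]%SET; rewrite (eq_card0 h) addn0 card_ord cards2.
by case: (i != j) => //= -[] e; rewrite -e in n0.
Qed.

Variables X A B : 'I_n.+2 -> lie_cycle R n.
Hypotheses (n_gt0 : (0 < n)%N) (X_inj : injective X)
  (A_tangent : forall i j, j != i -> tangent (A i) (X j))
  (hB : forall i, Ap (omit A i) = [set X i; B i]).

(** Stated for a single family, so that it serves both [A] and [A'] in the pigeonhole argument. *)
Lemma Ap_eq_P_uniq (P : proj 'rV[R]_n.+3) i j :
  (forall i, orth P (val (X i))) -> val (A i) = P -> val (A j) = P -> i = j.
Proof.
move=> PX Ai Aj; apply/eqP; apply: contraT => ij.
have [l [li lj]] := third_index i j n_gt0.
(* [X m] is tangent to [A q] for [q != m] by [A_tangent], and to [A m] because that is [P]. *)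
have Xall m : val (A m) = P -> Ap (omit A l) (X m).
  move=> Am _ [q ql <-]; apply/tangentE; rewrite lie_formC; apply/tangentE.
  have [->|mq] := eqVneq q m; first by rewrite /tangent Am.
  by apply: A_tangent; rewrite eq_sym.
have := Xall i Ai; have := Xall j Aj; rewrite hB.
case=> [/X_inj e|jB]; first by rewrite e eqxx in lj.
case=> [/X_inj e|iB]; first by rewrite e eqxx in li.
by move: ij; rewrite -(inj_eq X_inj) iB jB eqxx.
Qed.

End Configuration.

(** * The reflection in [p] acting on the cycles [B i] *)

Section Reflection.
Variables (R : realType) (n : nat) (X A A' B B' : 'I_n.+2 -> lie_cycle R n).
Local Notation vec C := (rep (val C)).
Variable p : 'rV[R]_n.+3.
Hypotheses (pp : lie_form p p != 0)
  (pX : forall i, lie_form p (vec (X i)) = 0)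
  (swap : forall i, refl p (vec (A i)) \in val (val (A' i)))
  (hB : forall i, Ap (omit A i) = [set X i; B i])
  (hB' : forall i, Ap (omit A' i) = [set X i; B' i]).

(** The reflection preserves the form and carries each [A j] to [A' j], so it carries tangency to
    [A j] into tangency to [A' j]. *)
Lemma refl_B i : refl p (vec (B i)) \in val (val (X i)) \/
  refl p (vec (B i)) \in val (val (B' i)).
Proof.
apply: (Ap_isotropic (hB' i)).
- exact: refl_neq0 (rep_neq0 _).
- by rewrite refl_isom // vec_isotropic.
- move=> _ [j ji <-]; have /proj_memP[a e] := swap j.
  have : lie_form (refl p (vec (B i))) (refl p (vec (A j))) = 0.
    by rewrite refl_isom // (Ap_r (hB i)) //; exact: omit_mem.
  rewrite e lie_formZr => /eqP; rewrite mulf_eq0 => /orP[/eqP a0|/eqP //].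
  have := refl_neq0 pp (rep_neq0 (val (A j))).
  by rewrite e a0 scale0r eqxx.
Qed.

(** The reflection is an involution fixing the representative of [X i], so only [X i] is mapped to
    [X i]. *)
Lemma refl_B_eq_X i : refl p (vec (B i)) \in val (val (X i)) -> B i = X i.
Proof.
move=> /proj_memP[a e]; apply: (cycle_inj (rep_neq0 (val (B i)))).
  exact: memv_pick.
apply/proj_memP; exists a; rewrite -(reflK pp (vec (B i))) e refl_orth //.
by rewrite lie_formZl lie_formC pX mulr0.
Qed.

End Reflection.

(** * Non-isotropy of [P] and concurrency of the lines of centers *)

Theorem theorem3p4 (R : realType) (n : nat) (n_gt0 : (0 < n)%N)
    (X A A' B B' : 'I_n.+2 -> lie_cycle R n)
    (X_inj : injective X)
    (hA : forall i, Ap (omit X i) = [set A i; A' i])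
    (A_neq : forall i, A i <> A' i)
    (hB : forall i, Ap (omit A i) = [set X i; B i])
    (hB' : forall i, Ap (omit A' i) = [set X i; B' i])
    (B_neq : forall i : 'I_n.+2, (i < n)%N -> B i <> B' i)
    (P : proj 'rV[R]_n.+3)
    (hP : forall i, orth P (val (X i))) :
  forall (i : 'I_n.+2) (b b' : proj 'rV[R]_n.+1), (i < n)%N ->
    lie_center (val (B i)) = Some b -> lie_center (val (B' i)) = Some b' -> b <> b' ->
    exists2 PX : proj 'rV[R]_n.+1,
      lie_center P = Some PX & on_line PX (proj_line b b').
Proof.
move=> i b b' _ cb cb' bb'.
pose p := rep P.
have pX j : lie_form p (rep (val (X j))) = 0 by apply/eqP; exact: hP.
have pS j E : omit X j E -> lie_form p (rep (val E)) = 0.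
  by case=> l _ <-.
have AX j l : l != j -> tangent (A j) (X l).
  by move=> lj; apply/tangentE; apply: (Ap_l (hA j)); exact: omit_mem.
have A'X j l : l != j -> tangent (A' j) (X l).
  by move=> lj; apply/tangentE; apply: (Ap_r (hA j)); exact: omit_mem.
have pp : lie_form p p != 0.
  apply/eqP => pp0.
  have AP j : val (A j) = P \/ val (A' j) = P.
    have := Ap_isotropic (hA j) (rep_neq0 P) pp0 (@pS j).
    by case=> h; [left|right]; apply: proj_inj (rep_neq0 P) h (memv_pick _).
  have uA j l := @Ap_eq_P_uniq _ _ _ _ _ n_gt0 X_inj AX hB P j l hP.
  have uA' j l := @Ap_eq_P_uniq _ _ _ _ _ n_gt0 X_inj A'X hB' P j l hP.
  have i01 : ord0 <> lift ord0 ord0 :> 'I_n.+2 by [].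
  (* Pigeonhole: of three distinct indices, two have [P] in the same family. *)
  have [l [/eqP l0 /eqP l1]] := third_index ord0 (lift ord0 ord0) n_gt0.
  have [a0|a0] := AP ord0; have [a1|a1] := AP (lift ord0 ord0);
    have [al|al] := AP l;
    first [exact: i01 (uA _ _ a0 a1) | exact: i01 (uA' _ _ a0 a1)
      | exact: l0 (uA _ _ al a0) | exact: l0 (uA' _ _ al a0)
      | exact: l1 (uA _ _ al a1) | exact: l1 (uA' _ _ al a1)].
have swap j : refl p (rep (val (A j))) \in val (val (A' j)).
  exact: (refl_swap (hA j) (@A_neq j) (@pS j) pp).
have swap' j : refl p (rep (val (A' j))) \in val (val (A j)).
  apply: (refl_swap _ (nesym (@A_neq j)) (@pS j) pp).
  by rewrite hA setUC.
(* In the degenerate case [B i] is [X i]; reflecting [B' i] back then lands on [X i] as well, so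
   [B' i] equals [B i] and the centers coincide. *)
have rB : refl p (rep (val (B i))) \in val (val (B' i)).
  have [/(refl_B_eq_X pp pX) BX|//] := refl_B pp swap hB hB' i.
  suff /(refl_B_eq_X pp pX) B'X : refl p (rep (val (B' i))) \in val (val (X i)).
    by case: bb'; move: cb'; rewrite B'X -BX cb => -[].
  by have [//|] := refl_B pp swap' hB' hB i; rewrite BX.
have /proj_memP[a] := rB; rewrite /refl; set t := - _ => wE.
(* Taking center coordinates is linear, so the relation between [B i], [P] and [B' i] passes to the
   centers. *)
have crE : center_row (rep (val (B i))) + t *: center_row p =
    a *: center_row (rep (val (B' i))).
  by move/rowP: wE => wE; apply/rowP => k; have := wE (inord k.+1); rewrite !mxE.
have /centerP/(_ _ (memv_pick _) (rep_neq0 _))[c0 bE] := cb.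
have /centerP/(_ _ (memv_pick _) (rep_neq0 _))[_ b'E] := cb'.
(* Otherwise the two centers would coincide. This shows both that [P] has a center and that the
   relation can be solved for it. *)
have tcr0 : t *: center_row p != 0.
  apply/eqP => tp0; apply: bb'; apply: (proj_inj c0).
    by rewrite bE memv_line.
  by rewrite b'E; apply/vlineP; exists a; rewrite -crE tp0 addr0.
have [t0 p0] : t != 0 /\ center_row p != 0.
  by move: tcr0; rewrite scaler_eq0 negb_or => /andP.
have d : \dim <[center_row p]>%VS == 1%N by rewrite dim_vline p0.
pose PX : proj 'rV[R]_n.+1 :=
  exist (fun U => \dim U == 1%N) <[center_row p]>%VS d.
exists PX; first by rewrite /lie_center insubT.
rewrite /on_line /proj_line -memvE bE b'E.
have -> : center_row p = t^-1 *: (- center_row (rep (val (B i)))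
    + a *: center_row (rep (val (B' i)))).
  by rewrite -crE addKr scalerA mulVf // scale1r.
by rewrite memvZ // memv_add // ?memvN ?memvZ ?memv_line.
Qed.
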